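(* For all $H\in(0,\frac12)$ and for all $\alpha\in(0,2H)$, there exists $C_{\alpha,H}\in(0,\infty)$ such that for all $\lambda\in(0,\infty)$, and all $t_1,t_2\ge 0$, one has \[ \mathbb{E}[|\mathcal{Z}^{H,\lambda}(t_2)-\mathcal{Z}^{H,\lambda}(t_1)|^2]\le C_{\alpha,H}\lambda^{\alpha-2H}|t_2-t_1|^\alpha. \]
   Context: $(\beta^H(t))_{t\ge0}$ is a real-valued fractional Brownian motion with Hurst index $H$ (centered Gaussian process with continuous paths and covariance $\frac12(t^{2H}+s^{2H}-|t-s|^{2H})$). For $\phi\in\mathcal{C}^1([0,t])$, $\int_0^t\phi(s)\,d\beta^H(s)=\phi(t)\beta^H(t)-\int_0^t\phi'(s)\beta^H(s)\,ds$. For $\lambda\in(0,\infty)$, the real-valued fractional Ornstein–Uhlenbeck process is $\mathcal{Z}^{H,\lambda}(t)=\int_0^te^{-\lambda(t-s)}\,d\beta^H(s)$, $t\ge0$. *)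

(* Defs.v *)
From HB Require Import structures.
From mathcomp Require Import all_boot all_order all_algebra.
From mathcomp Require Import all_classical all_reals all_analysis.

Set Implicit Arguments.
Unset Strict Implicit.
Unset Printing Implicit Defensive.

Import Order.TTheory GRing.Theory Num.Theory.
Import numFieldNormedType.Exports.

Local Open Scope classical_set_scope.
Local Open Scope ring_scope.

(* The normal law N(m, s ^+ 2).  The degenerate case must be separated:
   [normal_prob m 0] is the uniform law on [0, 1], not the Dirac mass at m. *)
Definition gaussian_law (R : realType) (m s : R) : set R -> \bar R :=
  if s == 0 then \d_m else normal_prob m s.

Definition gaussian_rv (R : realType) (d : measure_display)
    (T : measurableType d) (P : probability T R) (X : {RV P >-> R}) : Prop :=
  exists m s : R, 0 <= s /\
    forall A : set R, measurable A -> distribution P X A = gaussian_law m s A.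
Arguments gaussian_rv {R d T} P X.

(* Processes on the time set [0, +oo[ are given as families indexed by R; their
   values at negative times are never constrained nor used. *)
Definition gaussian_process (R : realType) (d : measure_display)
    (T : measurableType d) (P : probability T R) (X : R -> {RV P >-> R}) : Prop :=
  forall (n : nat) (a t : 'I_n -> R), (forall i, 0 <= t i) ->
    gaussian_rv P (\sum_(i < n) a i *: X (t i) : {mfun T >-> R}).
Arguments gaussian_process {R d T} P X.

Record is_fbm (R : realType) (d : measure_display) (T : measurableType d)
    (P : probability T R) (H : R) (B : R -> {RV P >-> R}) : Prop := IsFbm {
  fbm_gaussian : gaussian_process P B ;
  fbm_centered : forall t : R, 0 <= t -> ('E_P[B t] = 0)%E ;
  fbm_covariance : forall t s : R, 0 <= t -> 0 <= s ->
    covariance P (B t) (B s) =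
      (2^-1 * (t `^ (2 * H) + s `^ (2 * H) - `|t - s| `^ (2 * H)))%:E ;
  fbm_continuous : forall w : T,
    {within `[0, +oo[, continuous (fun t : R => B t w)} }.
Arguments is_fbm {R d T} P H B.

(* Integral of a C^1 function phi over [0, t] against the path b, defined by
   integration by parts; the values of phi outside [0, t] only affect the
   derivative at the two endpoints, a null set. *)
Definition path_integral (R : realType) (b phi : R -> R) (t : R) : R :=
  phi t * b t - \int[lebesgue_measure]_(s in `[0, t]) (phi^`()%classic s * b s).

Definition fOU (R : realType) (d : measure_display) (T : measurableType d)
    (P : probability T R) (lambda : R) (B : R -> {RV P >-> R}) (t : R) (w : T) : R :=
  path_integral (fun s => B s w) (fun s => expR (- lambda * (t - s))) t.
Arguments fOU {R d T} P lambda B t w.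

(* Main.v *)
Require Import Defs.
From HB Require Import structures.
From mathcomp Require Import all_boot all_order all_algebra.
From mathcomp Require Import all_classical all_reals all_analysis.
From mathcomp Require Import measurable_realfun.
From mathcomp Require Import ring lra.

Set Implicit Arguments.
Unset Strict Implicit.
Unset Printing Implicit Defensive.

Import Order.TTheory GRing.Theory Num.Theory.
Import numFieldNormedType.Exports.

Local Open Scope classical_set_scope.
Local Open Scope ring_scope.

(** Write b for a path of the fractional Brownian motion, set to 0 at negative
    times, and let p be the density of the exponential law of rate lambda.  The
    substitution u = t - s in the definition of the integral, together with
    the fact that p has mass 1, gives
      Z(t) = int p(u) (b(t) - b(t - u)) du,
    hence Z(t2) - Z(t1) = int p(u) G(u) du for the second difference
      G(u) = (b(t2) - b(t1)) - (b(t2 - u) - b(t1 - u)).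
    Extending by 0 is what makes both integrals run over the same half-line, and
    it preserves the bound E|b(t) - b(s)|^2 <= |t - s|^(2H), since b(0) = 0 in
    mean square.

    The two ways of pairing the four terms of G(u) give
      E|G(u)|^2 <= 4 min(|t2 - t1|, u)^(2H)
                <= 4 |t2 - t1|^alpha u^(2H - alpha)
    ([fbm_second_difference_le], [powR_min_le]).  By Jensen's inequality for the
    probability p(u) du ([sqr_Rintegral_le]) and by Tonelli's theorem,
      E|Z(t2) - Z(t1)|^2 <= 4 |t2 - t1|^alpha int p(u) u^(2H - alpha) du,
    and the last integral is at most a constant times lambda^(alpha - 2H):
    since 2H - alpha lies in [0, 1], the power x^(2H - alpha), at x = lambda u,
    is at most 2 exp(x / 2), which turns p into the exponential density of rate
    lambda / 2 ([exponential_pdf_powR_le]).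

    Tonelli's theorem calls for joint measurability in time and randomness, which
    continuity of the paths provides ([measurable_continuous_process]). *)

(** * Integration tools *)

Section integration.
Context {R : realType}.

(** The integral of a nonnegative function is a supremum over the simple
    functions below it, so it is monotone even among functions that are not
    measurable.  A pathwise bound on the increments of Z, which are integrals
    depending on a parameter, can thus be integrated over the paths at once. *)
Lemma le_integralT_ge0 d (T : measurableType d) (nu : {measure set T -> \bar R})
    (f g : T -> \bar R) :
  (forall x, 0 <= f x)%E -> (forall x, f x <= g x)%E ->
  (\int[nu]_x f x <= \int[nu]_x g x)%E.
Proof.
move=> f0 fg; have g0 x : (0 <= g x)%E by exact: le_trans (fg x).
rewrite !ge0_integralTE//; apply: le_ereal_sup => _ [h /= hf <-].
by exists h => //= x; exact: le_trans (fg x).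
Qed.

(** Jensen's inequality for the square and the probability of density p: with
    m the mean of f, integrate the tangent line bound 2 m f - m^2 <= f^2. *)
Lemma sqr_Rintegral_le d (T : measurableType d) (nu : {measure set T -> \bar R})
    (p f : T -> R) :
  (forall x, 0 <= p x) ->
  nu.-integrable setT (EFin \o p) -> \int[nu]_x p x = 1 ->
  nu.-integrable setT (EFin \o (fun x => p x * f x)) ->
  nu.-integrable setT (EFin \o (fun x => p x * f x ^+ 2)) ->
  (\int[nu]_x (p x * f x)) ^+ 2 <= \int[nu]_x (p x * f x ^+ 2).
Proof.
move=> p0 ip p1 ipf ipf2; set m := \int[nu]_x (p x * f x).
have ipm : nu.-integrable setT (EFin \o (fun x => m ^+ 2 * p x)).
  exact: (integrableZl _ (m ^+ 2) ip).
have impf : nu.-integrable setT (EFin \o (fun x => (2 * m) * (p x * f x))).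
  exact: (integrableZl _ (2 * m) ipf).
have -> : m ^+ 2 =
    \int[nu]_x ((2 * m) * (p x * f x) - m ^+ 2 * p x).
  rewrite RintegralB// !RintegralZl// -/m p1 mulr1 -mulrA mulr_natl -expr2.
  by rewrite mulr2n addrK.
apply: le_Rintegral => //.
  exact: (integrableB measurableT impf ipm).
move=> x _; rewrite -subr_ge0.
have -> : p x * f x ^+ 2 - (2 * m * (p x * f x) - m ^+ 2 * p x) =
  p x * (f x - m) ^+ 2 by ring.
by rewrite mulr_ge0// sqr_ge0.
Qed.

End integration.

(** * Joint measurability of continuous processes *)

Section process_measurability.
Context {R : realType}.

Definition extend0 (b : R -> R) (s : R) : R := if 0 <= s then b s else 0.

Lemma measurable_truncn_eq (k : nat) : measurable [set x : R | Num.truncn x = k].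
Proof.
have mle (n : nat) : measurable [set x : R | (Num.truncn x < n)%N].
  case: n => [|n]; first by rewrite [X in measurable X](_ : _ = set0)//; apply/seteqP; split.
  rewrite [X in measurable X](_ : _ = [set` `]-oo, n.+1%:R[%R])//.
  by apply/seteqP; split => x /=; rewrite ltnS truncn_le_nat in_itv.
rewrite [X in measurable X](_ : _ = [set x : R | (Num.truncn x < k.+1)%N] `\`
   [set x : R | (Num.truncn x < k)%N]); first exact: measurableD.
apply/seteqP; split => x /=; first by move=> ->; rewrite ltnS leqnn ltnn.
by move=> [+ /negP]; rewrite ltnS -leqNgt => a b; apply/eqP; rewrite eqn_leq a b.
Qed.

Lemma cvg_truncn_div (x : R) :
  (Num.truncn (x * n.+1%:R))%:R / n.+1%:R @[n --> \oo] --> Num.max x 0.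
Proof.
have [x0|x0] := leP 0 x; last first.
  rewrite (_ : (fun _ => _) = cst 0); first exact: cvg_cst.
  apply/funext => n /=; rewrite (_ : Num.truncn _ = 0%N) ?mul0r//.
  apply/eqP; rewrite -leqn0 truncn_le_nat (le_lt_trans _ ltr01)//.
  by rewrite mulr_le0_ge0// ltW.
apply/cvgrPdist_lt => e e0; near=> n.
have n0 : 0 < n.+1%:R :> R by rewrite ltr0n.
have /andP[h1 h2] := truncn_itv (mulr_ge0 x0 (ltW n0)).
have -> : x - (Num.truncn (x * n.+1%:R))%:R / n.+1%:R =
   (x * n.+1%:R - (Num.truncn (x * n.+1%:R))%:R) / n.+1%:R.
  by rewrite mulrBl mulfK// gt_eqF.
rewrite ger0_norm ?divr_ge0 ?subr_ge0//.
apply: (@le_lt_trans _ _ n.+1%:R^-1).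
  rewrite ler_pdivrMr// mulVf ?gt_eqF// lerBlDl (le_trans (ltW h2))//.
  by rewrite -natr1.
near: n; exact: near_infty_natSinv_lt (PosNum e0).
Unshelve. all: end_near. Qed.

(** The process is the pointwise limit of the processes frozen on the time grid
    of step 1 / (n + 1), each of which is a countable patching of random
    variables.  Negative times are first sent to 0, then cut off, so
    that the limit is taken along nonnegative times only. *)
Lemma measurable_continuous_process d (T : measurableType d) (X : R -> T -> R) :
  (forall t, 0 <= t -> measurable_fun setT (X t)) ->
  (forall w, {within `[0, +oo[, continuous (X ^~ w)}) ->
  measurable_fun [set: R * T] (fun z => extend0 (X ^~ z.2) z.1).
Proof.
move=> mX cX.
have mmax : measurable_fun [set: R * T] (fun z => X (Num.max z.1 0) z.2).
  pose h (n : nat) (z : R * T) := X ((Num.truncn (z.1 * n.+1%:R))%:R / n.+1%:R) z.2.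
  apply: (measurable_fun_cvg (h := h)) => [n|[x w] _]; last first.
    rewrite /h /=; have /subspace_continuousP := cX w.
    move/(_ (Num.max x 0)); rewrite /= in_itv/= andbT le_max lexx orbT => /(_ isT) cXw.
    (* the grid times stay in the half-line, where the path is continuous *)
    apply: (@cvg_comp _ _ _ _ (X ^~ w) _ _ _ _ cXw) => S.
    rewrite /within /= => wS.
    have := @cvg_truncn_div x _ wS; rewrite /nbhs/= /nbhs/=.
    apply: filterS => n; apply.
    by rewrite in_itv/= andbT divr_ge0.
  have -> : [set: R * T] = \bigcup_k ((fun x => x * n.+1%:R) @^-1`
      [set x : R | Num.truncn x = k] `*` [set: T]).
    by apply/seteqP; split => //= -[x w] _; exists (Num.truncn (x * n.+1%:R)).
  have mE k : measurable ((fun x => x * n.+1%:R) @^-1`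
      [set x : R | Num.truncn x = k] `*` [set: T]).
    apply: measurableX => //; rewrite -[X in measurable X]setTI.
    have mM : measurable_fun [set: R] (fun x => x * n.+1%:R).
      exact: measurable_funM.
    by apply: mM => //; exact: measurable_truncn_eq.
  apply/measurable_fun_bigcup => // k.
  apply: (@eq_measurable_fun _ _ _ _ _ (fun z : R * T => X (k%:R / n.+1%:R) z.2)).
    by move=> [x w]; rewrite inE => -[/= kx _]; rewrite /h /= kx.
  apply: measurable_funTS; apply: (measurableT_comp (mX _ _) measurable_snd).
  by rewrite divr_ge0.
rewrite (_ : (fun z => _) =
    (fun z : R * T => if 0 <= z.1 then X (Num.max z.1 0) z.2 else 0)); last first.
  apply/funext => -[x w]; rewrite /extend0 /=; case: ifPn => // x0.
  by rewrite (max_idPl x0).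
apply: measurable_fun_ifT => //.
exact: (measurable_fun_ler (measurable_cst (0 : R)) measurable_fst).
Qed.

End process_measurability.

(** * The Ornstein-Uhlenbeck integral as an exponential average *)

Section representation.
Context {R : realType}.
Local Notation mu := (@lebesgue_measure R).

Lemma Rintegral_reflect (f : R -> R) (t : R) : 0 <= t ->
  {within `[0, t], continuous f} ->
  \int[mu]_(s in `[0, t]) f s = \int[mu]_(u in `[0, t]) f (t - u).
Proof.
move=> t0 cf; congr fine.
have D : (fun u : R => t - u)^`()%classic = cst (-1).
  by apply/funext => x; rewrite derive1E deriveB// derive_cst derive_id add0r.
have cD : continuous (fun u : R => t - u).
  by move=> y; apply: cvgB; [exact: cvg_cst|exact: cvg_id].
have := @integration_by_substitution_decreasing R (fun u => t - u) f 0 t t0.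
rewrite subr0 subrr => -> //.
- by apply: eq_integral => x _; rewrite D !fctE opprK mulr1.
- by move=> x y _ _ xy; rewrite ltrD2l ltrN2.
- by rewrite D => ? _; exact: cvg_cst.
- by rewrite D; exact: is_cvg_cst.
- by rewrite D; exact: is_cvg_cst.
- split.
  + by move=> x _; exact: derivableB.
  + exact/cvg_at_right_filter/cD.
  + exact/cvg_at_left_filter/cD.
Qed.

Lemma derive1_expR_decay (lambda t s : R) :
  (fun s => expR (- lambda * (t - s)))^`()%classic s = lambda * expR (- lambda * (t - s)).
Proof.
have H : is_derive s 1 (fun s : R => - lambda * (t - s)) lambda.
  apply: is_derive_eq; rewrite /GRing.scale/=.
  by ring.
rewrite derive1E; have K := is_derive1_comp (is_derive_expR _) H.
by rewrite (@derive_val _ _ _ _ _ _ _ K) mulrC.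
Qed.

Lemma Rintegral_exponential_pdf (lambda : R) : 0 < lambda ->
  \int[mu]_u exponential_pdf lambda u = 1.
Proof. by move=> l0; rewrite /Rintegral integral_exponential_pdf. Qed.

Lemma continuous_extend0_bounded (b : R -> R) (t : R) :
  {within `[0, +oo[, continuous b} ->
  exists M, forall s, s <= t -> `|extend0 b s| <= M.
Proof.
move=> cb.
have ct : {within `[0, t], continuous b}.
  by apply: continuous_subspaceW cb; exact: subset_itvl.
have /compact_bounded : compact (b @` `[0, t]).
  by apply: continuous_compact => //; exact: segment_compact.
move=> [M [_ /(_ (Num.max M 0 + 1))]].
rewrite (@le_lt_trans _ _ (Num.max M 0)) ?le_max ?lexx// ?ltrDl// => /(_ isT) hM.
exists (Num.max M 0 + 1) => s st; rewrite /extend0; case: ifPn => s0.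
  by apply: hM; exists s => //=; rewrite in_itv/= s0.
by rewrite normr0 addr_ge0// le_max lexx orbT.
Qed.

Lemma integrable_exponential_pdf_mul (lambda M : R) (f : R -> R) : 0 < lambda ->
  measurable_fun setT f -> (forall u, 0 <= u -> `|f u| <= M) ->
  mu.-integrable setT (EFin \o (fun u => exponential_pdf lambda u * f u)).
Proof.
move=> l0 mf fM; have mp := @measurable_exponential_pdf R lambda.
have ip := integrable_exponential_pdf l0.
apply: (@le_integrable _ _ _ mu _ measurableT _
   (EFin \o (fun u => M * exponential_pdf lambda u))) => //=.
- by apply/measurable_EFinP; exact: measurable_funM.
- move=> u _; rewrite lee_fin !normrM.
  have [u0|u0] := ltP u 0; first by rewrite lt0_exponential_pdf// normr0 mul0r mulr0.
  by rewrite mulrC ler_wpM2r// (le_trans (fM _ u0))// ler_norm.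
- exact: (integrableZl measurableT M ip).
Qed.

(** The right-hand side integrates over a domain that does not depend on t, which
    is what allows increments in t to be taken under the integral. *)
Lemma path_integral_expE (lambda t : R) (b : R -> R) : 0 < lambda -> 0 <= t ->
  {within `[0, +oo[, continuous b} ->
  measurable_fun setT (extend0 b) ->
  path_integral b (fun s => expR (- lambda * (t - s))) t =
  \int[mu]_u (exponential_pdf lambda u * (extend0 b t - extend0 b (t - u))).
Proof.
move=> l0 t0 cb mb; rewrite /path_integral subrr mulr0 expR0 mul1r.
have ct : {within `[0, t], continuous b}.
  by apply: continuous_subspaceW cb; exact: subset_itvl.
have ce : {within `[0, t], continuous (fun s => lambda * expR (- lambda * (t - s)))}.
  apply: continuous_subspaceT => y.
  apply: cvgM; first exact: cvg_cst.
  apply: continuous_cvg; first exact: continuous_expR.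
  apply: cvgM; first exact: cvg_cst.
  by apply: cvgB; [exact: cvg_cst|exact: cvg_id].
under eq_Rintegral do rewrite derive1_expR_decay.
rewrite Rintegral_reflect//; last first.
  by move=> x; apply: cvgM; [exact: ce|exact: ct].
rewrite Rintegral_mkcond.
have [M hM] := continuous_extend0_bounded t cb.
have ib : mu.-integrable setT (EFin \o (fun u =>
    exponential_pdf lambda u * extend0 b (t - u))).
  apply: (@integrable_exponential_pdf_mul _ M) => //.
    by apply: (measurableT_comp mb); exact: measurable_funB.
  by move=> u u0; apply: hM; rewrite lerBlDr lerDl.
have ip := integrable_exponential_pdf l0.
have -> : b t = \int[mu]_u (extend0 b t * exponential_pdf lambda u).
  by rewrite RintegralZl// Rintegral_exponential_pdf// mulr1 /extend0 t0.
under [in RHS]eq_Rintegral do rewrite mulrBr [_ * extend0 b t]mulrC.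
rewrite [RHS]RintegralB//; last first.
  exact: (integrableZl measurableT (extend0 b t) ip).
congr (_ - _); apply: eq_Rintegral => u _; rewrite patchE.
case: ifPn => [|/negP]; rewrite inE/= in_itv/=.
  move=> /andP[u0 ut]; rewrite exponential_pdfE// /extend0 subr_ge0 ut.
  by rewrite opprB addrC subrK.
move=> h; have [u0|u0] := ltP u 0; first by rewrite lt0_exponential_pdf// mul0r.
rewrite /extend0 subr_ge0; case: ifPn; last by rewrite mulr0.
by move=> ut; exfalso; apply: h; rewrite u0 ut.
Qed.

Variables (lambda : R) (b : R -> R).
Hypothesis lambda_gt0 : 0 < lambda.
Hypothesis cb : {within `[0, +oo[, continuous b}.
Hypothesis mb : measurable_fun setT (extend0 b).
Local Notation p := (exponential_pdf lambda).
Local Notation Z := (fun t => path_integral b (fun s => expR (- lambda * (t - s))) t).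

Let G (t1 t2 u : R) := (extend0 b t2 - extend0 b t1) -
  (extend0 b (t2 - u) - extend0 b (t1 - u)).

Let measurable_shift (t : R) : measurable_fun setT (fun u : R => extend0 b (t - u)).
Proof. by apply: (measurableT_comp mb); exact: measurable_funB. Qed.

Let measurable_G t1 t2 : measurable_fun setT (G t1 t2).
Proof. by apply: measurable_funB => //; exact: measurable_funB. Qed.

Let integrable_pdf_increment (t : R) :
  mu.-integrable setT (EFin \o (fun u => p u * (extend0 b t - extend0 b (t - u)))).
Proof.
have [M hM] := continuous_extend0_bounded t cb.
apply: (@integrable_exponential_pdf_mul _ (M + M)) => //.
  exact: measurable_funB.
move=> u u0; rewrite (le_trans (ler_normB _ _))// lerD// hM//.
by rewrite lerBlDr lerDl.
Qed.

Let bounded_G t1 t2 : exists M, forall u, 0 <= u -> `|G t1 t2 u| <= M.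
Proof.
have [M1 h1] := continuous_extend0_bounded t1 cb.
have [M2 h2] := continuous_extend0_bounded t2 cb.
exists (M2 + M1 + (M2 + M1)) => u u0.
rewrite (le_trans (ler_normB _ _))//.
by apply: lerD; rewrite (le_trans (ler_normB _ _))// lerD// ?h1 ?h2// lerBlDr lerDl.
Qed.

Lemma sqr_path_integral_exp_increment_le (t1 t2 : R) : 0 <= t1 -> 0 <= t2 ->
  (((Z t2 - Z t1) ^+ 2)%:E <= \int[mu]_u (p u * G t1 t2 u ^+ 2)%:E)%E.
Proof.
move=> t10 t20; have [M hM] := bounded_G t1 t2.
have -> : Z t2 - Z t1 = \int[mu]_u (p u * G t1 t2 u).
  rewrite !path_integral_expE// -RintegralB//; apply: eq_Rintegral => u _.
  by rewrite /G; ring.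
have ipG2 : mu.-integrable setT (EFin \o (fun u => p u * G t1 t2 u ^+ 2)).
  apply: (@integrable_exponential_pdf_mul _ (M ^+ 2)) => //.
    exact: measurable_funX.
  move=> u u0; rewrite normrX lerXn2r ?nnegrE ?hM//.
  by rewrite (le_trans _ (hM _ u0)).
rewrite -[leRHS]fineK; last exact: (integrable_fin_num measurableT ipG2).
rewrite lee_fin; apply: sqr_Rintegral_le => //.
- by move=> u; apply: exponential_pdf_ge0; exact: ltW.
- exact: integrable_exponential_pdf.
- exact: Rintegral_exponential_pdf.
- exact: integrable_exponential_pdf_mul hM.
Qed.

End representation.

(** * Mean square of increments and second differences *)

Section moments.
Context {R : realType} d (T : measurableType d) (P : probability T R).

Lemma integral_sqrB_le (X Y : T -> R) :
  measurable_fun setT X -> measurable_fun setT Y ->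
  (\int[P]_w ((X w - Y w) ^+ 2)%:E <=
   2%:E * (\int[P]_w (X w ^+ 2)%:E + \int[P]_w (Y w ^+ 2)%:E))%E.
Proof.
move=> mX mY; have mX2 := measurable_funX 2 mX; have mY2 := measurable_funX 2 mY.
rewrite -ge0_integralD//=; try by move=> w _; rewrite lee_fin sqr_ge0.
- rewrite -ge0_integralZl//=.
  + apply: le_integralT_ge0 => w; first by rewrite lee_fin sqr_ge0.
    rewrite -EFinD -EFinM lee_fin -subr_ge0.
    have -> : 2 * (X w ^+ 2 + Y w ^+ 2) - (X w - Y w) ^+ 2 = (X w + Y w) ^+ 2 by ring.
    exact: sqr_ge0.
  + by apply: emeasurable_funD; apply/measurable_EFinP.
  + by move=> w _; rewrite -EFinD lee_fin addr_ge0// sqr_ge0.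
- exact/measurable_EFinP.
- exact/measurable_EFinP.
Qed.

Variables (H : R) (B : R -> {RV P >-> R}).
Hypothesis H0 : 0 < H.
Hypothesis fbmB : is_fbm P H B.

Lemma fbm_mean_mul (t s : R) : 0 <= t -> 0 <= s ->
  (\int[P]_w (B t w * B s w)%:E =
    (2^-1 * (t `^ (2 * H) + s `^ (2 * H) - `|t - s| `^ (2 * H)))%:E)%E.
Proof.
move=> t0 s0; rewrite -(fbm_covariance fbmB)// covariance.unlock.
rewrite !(fbm_centered fbmB)//= expectation.unlock.
by apply: eq_integral => w _; rewrite !fctE /= !subr0.
Qed.

Lemma fbm_mean_sqr (t : R) : 0 <= t ->
  (\int[P]_w ((B t w) ^+ 2)%:E = (t `^ (2 * H))%:E)%E.
Proof.
move=> t0; under eq_integral do rewrite expr2.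
rewrite fbm_mean_mul// subrr normr0 powR0 ?mulf_neq0 ?gt_eqF//.
by congr EFin; lra.
Qed.

Lemma fbm_integrable_mul (t s : R) : 0 <= t -> 0 <= s ->
  P.-integrable setT (EFin \o (fun w => B t w * B s w)).
Proof.
have isqr r : 0 <= r -> P.-integrable setT (EFin \o (fun w => B r w ^+ 2)).
  move=> r0; apply/integrableP; split.
    by apply/measurable_EFinP; exact: measurable_funX.
  under eq_integral do rewrite /= ger0_norm ?sqr_ge0//.
  by rewrite fbm_mean_sqr// ltry.
move=> t0 s0; apply: (@le_integrable _ _ _ P _ measurableT _
   (EFin \o (fun w => B t w ^+ 2 + B s w ^+ 2))) => //=.
- by apply/measurable_EFinP; exact: measurable_funM.
- move=> w _; rewrite lee_fin [leRHS]ger0_norm ?addr_ge0 ?sqr_ge0//.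
  rewrite normrM -(real_normK (num_real (B t w))) -(real_normK (num_real (B s w))).
  set a := `|B t w|; set b := `|B s w|.
  have ? : 0 <= (a - b) ^+ 2 by exact: sqr_ge0.
  have ? : 0 <= a ^+ 2 by exact: sqr_ge0.
  have ? : 0 <= b ^+ 2 by exact: sqr_ge0.
  by nra.
- exact: (integrableD measurableT (isqr _ t0) (isqr _ s0)).
Qed.

Lemma fbm_mean_sqr_increment (t s : R) : 0 <= t -> 0 <= s ->
  (\int[P]_w ((B t w - B s w) ^+ 2)%:E = (`|t - s| `^ (2 * H))%:E)%E.
Proof.
move=> t0 s0.
under eq_integral.
  move=> w _.
  rewrite (_ : _ ^+ 2 = B t w * B t w + B s w * B s w - 2 * (B t w * B s w)); last by ring.
  over.
have itt := fbm_integrable_mul t0 t0.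
have iss := fbm_integrable_mul s0 s0.
have its := fbm_integrable_mul t0 s0.
rewrite integralB_EFin//; last 2 first.
  exact: (integrableD measurableT itt iss).
  exact: (integrableZl measurableT 2 its).
rewrite integralD_EFin//.
under [X in (_ - X)%E]eq_integral do rewrite EFinM.
rewrite integralZl// !fbm_mean_mul//= !subrr normr0 powR0 ?mulf_neq0 ?gt_eqF//.
by rewrite -!EFinD; congr EFin; field.
Qed.

Let b s w := extend0 (fun r => B r w) s.

(** Between times of opposite signs the increment is the value at the nonnegative
    time t, of mean square t^(2H), and t is at most the elapsed time. *)
Lemma fbm_extend0_increment_le (t s : R) :
  (\int[P]_w ((b t w - b s w) ^+ 2)%:E <= (`|t - s| `^ (2 * H))%:E)%E.
Proof.
have mono x y : 0 <= x -> x <= y -> x `^ (2 * H) <= y `^ (2 * H).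
  move=> x0 xy; apply: ge0_ler_powR => //; rewrite ?nnegrE//.
    by rewrite mulr_ge0// ltW.
  exact: le_trans xy.
rewrite /b /extend0; case: (boolP (0 <= t)) => t0; case: (boolP (0 <= s)) => s0.
- by rewrite fbm_mean_sqr_increment.
- under eq_integral do rewrite subr0.
  rewrite fbm_mean_sqr// lee_fin mono//; move: s0; rewrite -ltNge => s0.
  by rewrite ger0_norm; lra.
- under eq_integral do rewrite sub0r sqrrN.
  rewrite fbm_mean_sqr// lee_fin mono//; move: t0; rewrite -ltNge => t0.
  by rewrite ler0_norm; lra.
- under eq_integral do rewrite subrr expr0n.
  by rewrite integral0 lee_fin powR_ge0.
Qed.

Lemma fbm_extend0_measurable (t : R) : measurable_fun setT (b t).
Proof. by rewrite /b /extend0; case: (0 <= t) => //; exact: measurable_cst. Qed.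

(** The second difference is both the difference of two increments over a time
    |t2 - t1| and, after regrouping, of two increments over a time u. *)
Lemma fbm_second_difference_le (t1 t2 u : R) : 0 <= u ->
  (\int[P]_w (((b t2 w - b t1 w) - (b (t2 - u) w - b (t1 - u) w)) ^+ 2)%:E <=
   (4 * Num.min `|t2 - t1| u `^ (2 * H))%:E)%E.
Proof.
move=> u0; have mb := fbm_extend0_measurable.
have bound (r1 r2 r3 r4 h : R) : `|r1 - r2| = h -> `|r3 - r4| = h ->
    (\int[P]_w (((b r1 w - b r2 w) - (b r3 w - b r4 w)) ^+ 2)%:E <=
   (4 * h `^ (2 * H))%:E)%E.
  move=> h12 h34; apply: le_trans (integral_sqrB_le _ _) _.
  - exact: measurable_funB.
  - exact: measurable_funB.
  rewrite (_ : 4 * _ = 2 * (h `^ (2 * H) + h `^ (2 * H))); last by ring.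
  rewrite EFinM; apply: lee_wpmul2l; first by rewrite lee_fin.
  rewrite [leRHS]EFinD; apply: leeD.
    by rewrite -h12 fbm_extend0_increment_le.
  by rewrite -h34 fbm_extend0_increment_le.
have [hu|uh] := leP `|t2 - t1| u.
  by apply: bound => //; congr `|_|; ring.
have -> : (fun w => (((b t2 w - b t1 w) - (b (t2 - u) w - b (t1 - u) w)) ^+ 2)%:E) =
    (fun w => (((b t2 w - b (t2 - u) w) - (b t1 w - b (t1 - u) w)) ^+ 2)%:E).
  by apply/funext => w; congr (_ ^+ 2)%:E; ring.
by apply: bound; rewrite subKr ger0_norm.
Qed.

End moments.

(** * Power weights against the exponential density *)

Section weights.
Context {R : realType}.

(** Each of the factors m^a and m^(q - a) of m^q is monotone in m, so one is
    bounded through m <= h and the other through m <= u. *)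
Lemma powR_min_le (a q h u : R) : 0 < a -> a <= q -> 0 <= h -> 0 <= u ->
  Num.min h u `^ q <= h `^ a * u `^ (q - a).
Proof.
move=> a0 aq h0 u0; set m := Num.min h u.
have m0 : 0 <= m by rewrite le_min h0 u0.
have -> : m `^ q = m `^ a * m `^ (q - a).
  rewrite -powRD; first by rewrite addrC subrK.
  by rewrite addrC subrK gt_eqF// (lt_le_trans a0).
by apply: ler_pM; rewrite ?powR_ge0// ge0_ler_powR ?nnegrE// ?subr_ge0 ?ge_min ?lexx ?orbT// ltW.
Qed.

Lemma powR_le_expR_half (q x : R) : 0 <= q <= 1 -> 0 <= x -> x `^ q <= 2 * expR (x / 2).
Proof.
move=> /andP[q0 q1] x0; have ex := expR_ge1Dx (x / 2).
have [x1|x1] := leP x 1; last first.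
  apply: (@le_trans _ _ (x `^ 1)); first by rewrite ler_powR// ltW.
  by rewrite powRr1//; lra.
apply: (@le_trans _ _ 1); last by lra.
have <- : 1 `^ q = 1 by rewrite powR1.
by rewrite ge0_ler_powR// nnegrE.
Qed.

(** Half of the exponential decay absorbs the power of u; what remains is again a
    probability density up to the factor, so its integral is known. *)
Lemma exponential_pdf_powR_le (lambda q u : R) : 0 < lambda -> 0 <= q <= 1 -> 0 <= u ->
  exponential_pdf lambda u * u `^ q <=
  4 * lambda `^ (- q) * exponential_pdf (lambda / 2) u.
Proof.
move=> l0 q01 u0; rewrite !exponential_pdfE//.
have -> : u `^ q = lambda `^ (- q) * (lambda * u) `^ q.
  by rewrite powRM ?(ltW l0)// mulrA -powRD ?addNr ?powRr0 ?mul1r// eqxx/= gt_eqF.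
have -> : - (lambda / 2) * u = - lambda * u + lambda * u / 2 by field.
rewrite expRD.
have := powR_le_expR_half q01 (mulr_ge0 (ltW l0) u0).
set E := expR (- lambda * u); set F := expR (_ / 2); set L := lambda `^ _.
move=> h; have cE : 0 <= lambda * E * L.
  by rewrite !mulr_ge0 ?expR_ge0 ?powR_ge0// ltW.
have -> : 4 * L * (lambda / 2 * (E * F)) = lambda * E * L * (2 * F) by field.
by rewrite mulrA ler_wpM2l.
Qed.

End weights.

Theorem lemmaC2 (R : realType) (H alpha : R) :
  0 < H < 2^-1 -> 0 < alpha < 2 * H ->
  exists C : R, 0 < C /\
    forall (d : measure_display) (T : measurableType d) (P : probability T R)
      (B : R -> {RV P >-> R}), is_fbm P H B ->
    forall lambda : R, 0 < lambda ->
    forall t1 t2 : R, 0 <= t1 -> 0 <= t2 ->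
      ('E_P[fun w => (`|fOU P lambda B t2 w - fOU P lambda B t1 w| ^+ 2)%R] <=
        (C * lambda `^ (alpha - 2 * H) * `|t2 - t1| `^ alpha)%R%:E)%E.
Proof.
move=> /andP[H0 H12] /andP[a0 aH].
(* 16 = 4 * 4: one factor from the second difference, one from the weight *)
exists 16; split=> //.
move=> d T P B fbmB lambda l0 t1 t2 t10 t20.
pose mu := @lebesgue_measure R.
pose p := exponential_pdf lambda.
have p0 u : 0 <= p u by apply: exponential_pdf_ge0; exact: ltW.
have mp : measurable_fun setT p by exact: measurable_exponential_pdf.
have cB w : {within `[0, +oo[, continuous (fun r => B r w)}.
  exact: (fbm_continuous fbmB).
pose b (z : R * T) := extend0 (fun r => B r z.2) z.1.
have mb : measurable_fun [set: R * T] b.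
  exact: (@measurable_continuous_process _ _ _ (fun t w => B t w)).
pose G (u : R) (w : T) :=
  (b (t2, w) - b (t1, w)) - (b (t2 - u, w) - b (t1 - u, w)).
have mG : measurable_fun [set: R * T] (fun z => G z.1 z.2).
  have mbt (f : R * T -> R) : measurable_fun setT f ->
      measurable_fun setT (fun z : R * T => b (f z, z.2)).
    move=> mf; apply: (measurableT_comp mb); apply/measurable_fun_pairP.
    by split=> //; exact: measurable_snd.
  by apply: measurable_funB; apply: measurable_funB; apply: mbt => //;
    apply: measurable_funB => //; exact: measurable_fst.
rewrite expectation.unlock.
apply: (@le_trans _ _ (\int[P]_w \int[mu]_u (p u * G u w ^+ 2)%:E)%E).
  apply: le_integralT_ge0 => w; first by rewrite lee_fin sqr_ge0.
  rewrite real_normK ?num_real//.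
  apply: (sqr_path_integral_exp_increment_le l0 (cB w)) => //.
  exact: measurableT_comp mb (measurable_pair2 w).
pose F (z : R * T) : \bar R := (p z.1 * G z.1 z.2 ^+ 2)%:E.
have mF : measurable_fun setT F.
  apply/measurable_EFinP; apply: measurable_funM; last exact: measurable_funX.
  exact: measurableT_comp mp measurable_fst.
have F0 z : (0 <= F z)%E by rewrite lee_fin mulr_ge0// sqr_ge0.
have -> : (\int[P]_w \int[mu]_u (p u * G u w ^+ 2)%:E =
    \int[mu]_u \int[P]_w (p u * G u w ^+ 2)%:E)%E.
  exact: esym (@fubini_tonelli _ _ _ _ _ mu P F mF F0).
pose K := 16 * lambda `^ (alpha - 2 * H) * `|t2 - t1| `^ alpha.
have K0 : 0 <= K by rewrite !mulr_ge0 ?powR_ge0.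
apply: (@le_trans _ _ (\int[mu]_u (K * exponential_pdf (lambda / 2) u)%:E)%E).
  apply: le_integralT_ge0 => u.
    by apply: integral_ge0 => w _; rewrite lee_fin mulr_ge0// sqr_ge0.
  under eq_integral do rewrite EFinM.
  rewrite ge0_integralZl//=; last 3 first.
  - apply/measurable_EFinP; apply: measurable_funX.
    exact: measurableT_comp mG (measurable_pair1 u).
  - by move=> w _; rewrite lee_fin sqr_ge0.
  - by rewrite lee_fin.
  have [u0|u0] := ltP u 0.
    by rewrite /p !lt0_exponential_pdf// mulr0 mul0e.
  have GH := fbm_second_difference_le H0 fbmB t1 t2 u0.
  apply: le_trans (lee_wpmul2l _ GH) _; first by rewrite lee_fin.
  rewrite -EFinM lee_fin.
  apply: (@le_trans _ _ (p u * (4 * (`|t2 - t1| `^ alpha * u `^ (2 * H - alpha))))).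
    by rewrite !ler_wpM2l// powR_min_le// ltW.
  have q01 : 0 <= 2 * H - alpha <= 1 by apply/andP; split; lra.
  have := exponential_pdf_powR_le l0 q01 u0.
  rewrite opprB => pw.
  have -> : p u * (4 * (`|t2 - t1| `^ alpha * u `^ (2 * H - alpha))) =
    4 * `|t2 - t1| `^ alpha * (p u * u `^ (2 * H - alpha)) by ring.
  apply: le_trans (ler_wpM2l _ pw) _; first by rewrite mulr_ge0 ?powR_ge0.
  by rewrite /K le_eqVlt; apply/orP; left; apply/eqP; ring.
have l20 : 0 < lambda / 2 by rewrite divr_gt0.
under eq_integral do rewrite EFinM.
rewrite integralZl//; last exact: integrable_exponential_pdf.
by rewrite integral_exponential_pdf// mule1.
Qed.
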